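(* Fix $K\ge3$, $\theta>0$, $p>0$ and, for $N\ge2$, let $\nu_N$ be the stationary distribution of the $N$-particle process on $\mathcal{E}_{K,N}$ with generator $\mathcal{L}_{K,N}$. For each $k\in\{0,1,\dots,K-1\}$, as $N\to\infty$, \[ \begin{aligned} \operatorname{Cov}_{\nu_N}\left[\frac{\eta(0)}{N},\frac{\eta(k)}{N}\right]={}&\frac1{KN}\left(\mathbf{1}_{\{k=0\}}-\frac1K+\frac{6k(k-K)+K^2-1}{6K}\,\frac{p}{1+\theta}\right)\\ &+\frac{1}{K^2N^2}\,\frac{30k(K-k)[k(K-k)+2]-(K^2-1)(K^2+11)}{180}\left(\frac{p}{1+\theta}\right)^2+o\left(\frac1{N^2}\right). \end{aligned} \]
   Context: $\mathcal{E}_{K,N}=\{\eta:\mathbb{Z}/K\mathbb{Z}\to\mathbb{N},\ \sum_{k}\eta(k)=N\}$ ($\mathbb{N}$ includes $0$). The generator is \[ (\mathcal{L}_{K,N}f)(\eta)=\sum_{i,j\in\mathbb{Z}/K\mathbb{Z}}\eta(i)\left(\mathbf{1}_{\{j=i+1\}}+\theta\,\mathbf{1}_{\{j=i-1\}}+p\frac{\eta(j)}{N-1}\right)[f(T_{i\to j}\eta)-f(\eta)], \] with $T_{i\to j}\eta=\eta-\mathbf{e}_i+\mathbf{e}_j$ (when $\eta(i)>0$). The process is irreducible and $\nu_N$ is its unique stationary distribution; $\operatorname{Cov}_{\nu_N}$ is the covariance when $\eta$ has law $\nu_N$. *)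

(* Defs.v *)
From HB Require Import structures.
From mathcomp Require Export all_boot all_order all_algebra.
From mathcomp Require Export all_classical all_reals all_analysis.

Set Implicit Arguments.
Unset Strict Implicit.
Unset Printing Implicit Defensive.

Export Order.TTheory GRing.Theory Num.Theory.
Export numFieldNormedType.Exports.

Local Open Scope ring_scope.

(* Occupation configurations on the cycle.  Since ['Z_K] denotes Z/2Z when
   K < 2, this is the intended space only for 1 < K. *)
Record config (K N : nat) := Config {
  occupation :> {ffun 'Z_K -> nat};
  config_total : (\sum_k occupation k)%N == N }.

HB.instance Definition _ K N := [isSub for @occupation K N].
HB.instance Definition _ K N := [Countable of config K N by <:].

Lemma pile_total (K N : nat) :
  (\sum_k [ffun k : 'Z_K => if k == 0%R then N else 0%N] k)%N == N.
Proof.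
rewrite (bigD1 (0%R : 'Z_K)) //= ffunE eqxx big1 ?addn0 // => k /negPf k0.
by rewrite ffunE k0.
Qed.

Definition pile (K N : nat) : config K N := Config (pile_total K N).

HB.instance Definition _ K N := isPointed.Build (config K N) (pile K N).
HB.instance Definition _ K N :=
  @isMeasurable.Build default_measure_display (config K N)
    discrete_measurable discrete_measurable0
    discrete_measurableC discrete_measurableU.

(* When there is no particle at i, the truncated formula has N + 1 particles,
   so [insubd] returns eta itself. *)
Definition jump (K N : nat) (i j : 'Z_K) (eta : config K N) : config K N :=
  insubd eta [ffun k => eta k - (k == i) + (k == j)]%N.

Lemma jumpE (K N : nat) (i j : 'Z_K) (eta : config K N) (k : 'Z_K) :
  (0 < eta i)%N -> jump i j eta k = (eta k - (k == i) + (k == j))%N.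
Proof.
move=> eta_i; rewrite /jump /insubd insubT /=; last by rewrite ffunE.
have sum_pt (l : 'Z_K) : (\sum_m (m == l))%N = 1%N.
  by rewrite (bigD1 l) //= eqxx big1 // => m /negPf ->.
have le_pt m : ((m == i) <= eta m)%N by case: eqP => [->|].
under eq_bigr do rewrite ffunE.
rewrite big_split /= sum_pt sumnB // sum_pt (eqP (config_total eta)) subnK //.
by rewrite -(eqP (config_total eta)) (leq_trans eta_i) // (bigD1 i) //= leq_addr.
Qed.

Definition jump_rate (R : realType) (K N : nat) (theta p : R)
    (eta : config K N) (i j : 'Z_K) : R :=
  (eta i)%:R * ((j == i + 1)%:R + theta * (j == i - 1)%:R
                + p * ((eta j)%:R / (N%:R - 1))).

Definition generator (R : realType) (K N : nat) (theta p : R)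
    (f : config K N -> R) : config K N -> R :=
  fun eta => \sum_(i : 'Z_K) \sum_(j : 'Z_K)
    jump_rate theta p eta i j * (f (jump i j eta) - f eta).

Definition stationary (R : realType) (K N : nat) (theta p : R)
    (nu : probability (config K N) R) : Prop :=
  forall f : config K N -> R, ('E_nu[generator theta p f] = 0)%E.

(* Main.v *)
Require Import Defs.
From mathcomp Require Import ring lra zify.

(** The generator maps polynomials of degree at most two in the occupation
numbers to polynomials of degree at most two, so stationarity gives closed
linear systems for the first two moments.

For the first moments the symmetric attraction drops out; what remains says
that the mean occupation is harmonic for a one-particle walk on the cycle, so
it is constant, equal to [N / K] ([first_momentE]).

For the second moments [S k l] one finds the equation of two independent
walks killed at rate [c = 2 p / (N - 1)], with sources on and next to the
diagonal ([second_moment_eq]). A function of the difference [r = l - k] feels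
the two walks only through [(1 + theta)] times the Laplacian of the cycle; after
subtraction of a diagonal term, the system for such functions reads
[e G - laplacian G = e delta_0] with [e = c / (1 + theta)], where [N (N - 1) / K * G]
represents the second factorial moments. As [e] is of order [1 / N], the
stated expansion is that of the Green function [G] in powers of [e]: the
coefficients are obtained by repeatedly inverting the Laplacian, which on the
cycle yields explicit polynomials in [r (K - r)] ([laplacian_potential1],
[laplacian_potential2], [laplacian_potential3]).

The truncated expansion solves the system of second moments up to an explicit
residual ([approx_moment_eq]), and a maximum principle for the killed walks
([walk2_max_principle]) bounds its distance to the true moments
([second_moment_approx]); in particular, it is the maximum principle that forces
the moments of a stationary law to be invariant under rotations up to the
error. The expansion is carried one order further than the
theorem displays, because the maximum principle loses one power of [e]. The
error on the covariance is then of order [1 / N ^+ 3]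
([covariance_expansion]). *)

Set Implicit Arguments.
Unset Strict Implicit.
Unset Printing Implicit Defensive.

Local Open Scope classical_set_scope.
Local Open Scope ring_scope.

(** * Expectations of functions of a configuration *)

Lemma occupation_le (K N : nat) (eta : config K N) (k : 'Z_K) : (eta k <= N)%N.
Proof.
by apply: leq_trans (eq_leq (eqP (config_total eta))); rewrite (bigD1 k) //= leq_addr.
Qed.

Lemma sum_occupation (R : realType) (K N : nat) (eta : config K N) :
  \sum_k (eta k)%:R = N%:R :> R.
Proof. by rewrite -natr_sum (eqP (config_total eta)). Qed.

(** There are only finitely many configurations, since each is determined by a
function into the integers at most [N]; hence no integrability question ever
arises, and the expectation is a linear form on all functions. *)
Lemma config_fun_bounded (R : realType) (K N : nat) (f : config K N -> R) :
  exists M, forall eta, `|f eta| <= M.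
Proof.
pose conf (g : {ffun 'Z_K -> 'I_N.+1}) : config K N :=
  insubd (pile K N) [ffun k => nat_of_ord (g k)].
(* Summing over codes in a finite type avoids enumerating configurations. *)
exists (\sum_g `|f (conf g)|) => eta.
pose g := [ffun k => inord (eta k) : 'I_N.+1].
suff <- : conf g = eta by rewrite (bigD1 g) //= lerDl sumr_ge0.
have gE : [ffun k => nat_of_ord (g k)] = occupation eta.
  by apply/ffunP => k; rewrite !ffunE inordK // ltnS occupation_le.
by apply: val_inj; rewrite val_insubd gE config_total.
Qed.

Definition mean (R : realType) (K N : nat) (nu : probability (config K N) R)
  (f : config K N -> R) : R := fine ('E_nu[f])%E.

Lemma config_integrable (R : realType) (K N : nat)
    (nu : probability (config K N) R) (f : config K N -> R) :
  nu.-integrable setT (EFin \o f).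
Proof.
apply: measurable_bounded_integrable => //.
- by rewrite (le_lt_trans (probability_le1 _ _)) // ltry.
- have [M fM] := config_fun_bounded f.
  exists M; split => [|x Mx eta _]; first exact: num_real.
  exact: le_trans (fM _) (ltW Mx).
Qed.

Section Mean.
Context (R : realType) (K N : nat) (nu : probability (config K N) R).
Implicit Types f g : config K N -> R.

Lemma mean_fin f : ('E_nu[f])%E = (mean nu f)%:E.
Proof.
rewrite /mean fineK // unlock; apply: integrable_fin_num => //.
exact: config_integrable.
Qed.

Lemma meanD f g : mean nu (fun x => f x + g x) = mean nu f + mean nu g.
Proof.
rewrite /mean unlock -fineD; try exact: integrable_fin_num (config_integrable _ _).
congr fine; under eq_integral do rewrite EFinD.
exact: integralD_EFin (config_integrable _ _) (config_integrable _ _).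
Qed.

Lemma meanZ c f : mean nu (fun x => c * f x) = c * mean nu f.
Proof.
rewrite /mean unlock; under eq_integral do rewrite EFinM.
rewrite integralZl //; last exact: config_integrable.
by rewrite fineM //; exact: integrable_fin_num (config_integrable _ _).
Qed.

Lemma meanB f g : mean nu (fun x => f x - g x) = mean nu f - mean nu g.
Proof.
rewrite -mulN1r -meanZ -meanD; congr mean.
by apply/funext => x; rewrite mulN1r.
Qed.

Lemma mean_cst c : mean nu (fun=> c) = c.
Proof. by rewrite /mean expectation_cst. Qed.

Lemma mean_sum (I : finType) (F : I -> config K N -> R) :
  mean nu (fun x => \sum_i F i x) = \sum_i mean nu (F i).
Proof.
elim: (index_enum I) => [|i s IHs].
  by rewrite big_nil -[RHS]mean_cst; congr mean; apply/funext => x; rewrite big_nil.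
by rewrite big_cons -IHs -meanD; congr mean; apply/funext => x; rewrite big_cons.
Qed.

End Mean.

(** * Green function of the cycle *)

Section Potentials.
Context (R : realType) (K : nat).
Hypothesis K_gt1 : (1 < K)%N.
Local Notation Kr := (K%:R : R).
Implicit Types (r : 'Z_K) (G : 'Z_K -> R).

(** In the computations below the case of equality is the edge of the cycle that
joins [K - 1] to [0]. *)
Lemma Zp_succ_val r :
  nat_of_ord (r + 1) = (if r.+1 == K then 0 else r.+1)%N.
Proof.
case: K K_gt1 r => [|[|n]] // _ r; rewrite [LHS]/= (@modn_small 1) // addn1.
have r_lt : (r < n.+2)%N := ltn_ord r.
by case: eqP => [->|/eqP r_max]; rewrite ?modnn // modn_small // ltn_neqAle r_max.
Qed.

Lemma Zp_pred_val r : r != 0 -> nat_of_ord (r - 1) = r.-1.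
Proof.
move=> r0; have := Zp_succ_val (r - 1); rewrite subrK.
case: eqP => _ E; last by rewrite E.
by case/eqP: r0; apply: val_inj.
Qed.

(** Product of the lengths of the two arcs from [0] to [r]. Being symmetric
under the exchange of the arcs, a polynomial in it is consistent on the cycle. *)
Definition arc_product r : R := r%:R * (Kr - r%:R).

Definition laplacian G r : R := G (r + 1) + G (r - 1) - 2 * G r.

Lemma arc_product0 : arc_product 0 = 0.
Proof. by rewrite /arc_product mul0r. Qed.

(** No exception at [r = K - 1]: the right-hand side vanishes there, as does
the arc product at [0]. *)
Lemma arc_product_succ r : arc_product (r + 1) = (r%:R + 1) * (Kr - r%:R - 1).
Proof.
rewrite /arc_product Zp_succ_val; case: eqP => [r_max|_]; last by rewrite -natr1; ring.
have -> : Kr = r%:R + 1 by rewrite natr1 r_max.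
by ring.
Qed.

Lemma arc_product_pred r : r != 0 ->
  arc_product (r - 1) = (r%:R - 1) * (Kr - r%:R + 1).
Proof.
move=> r0; rewrite /arc_product Zp_pred_val //.
have r_gt0 : (0 < r)%N.
  by rewrite lt0n; apply: contra r0 => /eqP r0; apply/eqP/val_inj.
by rewrite -[in RHS](prednK r_gt0) -natr1; ring.
Qed.

Lemma arc_product_succ0 : arc_product (0 + 1) = Kr - 1.
Proof. by rewrite arc_product_succ add0r mul1r subr0. Qed.

Lemma arc_product_pred0 : arc_product (0 - 1) = Kr - 1.
Proof.
rewrite /arc_product; have := Zp_succ_val (0 - 1); rewrite subrK.
case: eqP => // r_max _.
have -> : Kr = (nat_of_ord (0 - 1 : 'Z_K))%:R + 1 by rewrite natr1 r_max.
by ring.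
Qed.

(** Coefficients of the expansion in [e] of the Green function [G] solving
[e G - laplacian G = e delta_0]. The zeroth one is the constant [1 / K]; each
further one has the preceding one as its Laplacian, up to the mass at [0] for
the first. A solution on the cycle can exist only if the right-hand side has
sum zero, which fixes the additive constants of the first two. *)
Definition potential1 r : R := (Kr ^+ 2 - 1 - 6 * arc_product r) / (12 * Kr).
Definition potential2 r : R :=
  (30 * arc_product r * (arc_product r + 2)
   - (Kr ^+ 2 - 1) * (Kr ^+ 2 + 11)) / (720 * Kr).
(** Its additive constant is free, since no further coefficient is built on it;
it is chosen so that the potential vanishes at [0]. *)
Definition potential3 r : R :=
  - (2 * arc_product r ^+ 3 + (Kr ^+ 2 + 15) * arc_product r ^+ 2
     + 24 * arc_product r) / (1440 * Kr).

Let K_neq0 : Kr != 0. Proof. by rewrite pnatr_eq0; lia. Qed.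

(** At [0] both neighbours have arc product [K - 1]; at the other points the
polynomial formulas of both neighbours apply. *)
Lemma laplacian_potential1 r : laplacian potential1 r = Kr^-1 - (r == 0)%:R.
Proof.
rewrite /laplacian /potential1; have [->|r0] := eqVneq r 0.
  by rewrite arc_product_succ0 arc_product_pred0 arc_product0 ?mulr1n; field.
by rewrite arc_product_succ arc_product_pred // /arc_product ?mulr0n; field.
Qed.

Lemma laplacian_potential2 r : laplacian potential2 r = potential1 r.
Proof.
rewrite /laplacian /potential2 /potential1; have [->|r0] := eqVneq r 0.
  by rewrite arc_product_succ0 arc_product_pred0 arc_product0 ?mulr1n; field.
by rewrite arc_product_succ arc_product_pred // /arc_product ?mulr0n; field.
Qed.

Lemma laplacian_potential3 r : laplacian potential3 r = potential2 r.
Proof.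
rewrite /laplacian /potential3 /potential2; have [->|r0] := eqVneq r 0.
  by rewrite arc_product_succ0 arc_product_pred0 arc_product0 ?mulr1n; field.
by rewrite arc_product_succ arc_product_pred // /arc_product ?mulr0n; field.
Qed.

Definition resolvent_expansion (e : R) r : R :=
  Kr^-1 + e * potential1 r + e ^+ 2 * potential2 r + e ^+ 3 * potential3 r.

(** The sum telescopes, so only the last term of the expansion is left over. *)
Lemma laplacian_resolvent_expansion e r :
  laplacian (resolvent_expansion e) r
  = e * resolvent_expansion e r - e * (r == 0)%:R - e ^+ 4 * potential3 r.
Proof.
have -> : laplacian (resolvent_expansion e) r = e * laplacian potential1 r
  + e ^+ 2 * laplacian potential2 r + e ^+ 3 * laplacian potential3 r.
  by rewrite /laplacian /resolvent_expansion; ring.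
rewrite laplacian_potential1 laplacian_potential2 laplacian_potential3.
by rewrite /resolvent_expansion; ring.
Qed.

End Potentials.

(** * Maximum principle for walks on the cycle *)

Section MaximumPrinciple.
Context (R : realType) (K : nat) (theta : R).
Hypotheses (theta_gt0 : 0 < theta).
Implicit Types (k l : 'Z_K).

(** Forward operator of one particle jumping to the right at rate [1] and to the
left at rate [theta]: inflow minus outflow at [k]. *)
Definition walk (f : 'Z_K -> R) k : R :=
  f (k - 1) + theta * f (k + 1) - (1 + theta) * f k.

(** At a maximum point both neighbours must be maximal as well, so the maximum
spreads around the whole cycle by steps to the left. *)
Lemma walk_harmonic_const (f : 'Z_K -> R) :
  (forall k, walk f k = 0) -> forall k l, f k = f l.
Proof.
move=> harm.
case: (@Order.TotalTheory.arg_maxP _ _ _ (0 : 'Z_K) xpredT f isT) => k0 _ max_k0.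
suff fk0 k : f k = f k0 by move=> k l; rewrite !fk0.
suff fn n : f (k0 - n%:R) = f k0.
  by rewrite -(fn (nat_of_ord (k0 - k))) natr_Zp opprB addrC subrK.
elim: n => [|n IHn]; first by rewrite subr0.
have := harm (k0 - n%:R); rewrite /walk IHn -natr1 opprD addrA.
move=> harm_n; have le_pred := max_k0 (k0 - n%:R - 1) isT.
have le_succ : 0 <= theta * (f k0 - f (k0 - n%:R + 1)).
  by apply: mulr_ge0; [exact: ltW | rewrite subr_ge0; exact: max_k0].
rewrite /= in le_pred; lra.
Qed.

(** At a maximum point of [D] both walks contribute a nonpositive amount, so the
killing rate [c] alone bounds the maximum. This replaces any inversion of the
linear system of second moments. *)
Lemma walk2_max_principle (D : 'Z_K -> 'Z_K -> R) (c B : R) :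
  0 < c ->
  (forall k l, c * D k l <= walk (D^~ l) k + walk (D k) l + c * B) ->
  forall k l, D k l <= B.
Proof.
move=> c_gt0 subsol.
case: (@Order.TotalTheory.arg_maxP _ _ _ (0 : 'Z_K * 'Z_K) xpredT
  (fun x => D x.1 x.2) isT).
move=> [k0 l0] _ /= max_kl k l.
apply: le_trans (max_kl (k, l) isT) _ => /=.
rewrite -(ler_pM2l c_gt0); apply: le_trans (subsol k0 l0) _.
rewrite gerDr /walk.
have le_pred1 := max_kl (k0 - 1, l0) isT; have le_pred2 := max_kl (k0, l0 - 1) isT.
have le_succ k' l' : 0 <= theta * (D k0 l0 - D k' l').
  by apply: mulr_ge0; [exact: ltW | rewrite subr_ge0; exact: (max_kl (k', l') isT)].
have le_succ1 := le_succ (k0 + 1) l0; have le_succ2 := le_succ k0 (l0 + 1).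
rewrite /= in le_pred1 le_pred2; lra.
Qed.

End MaximumPrinciple.

(** * The generator on polynomials of degree at most two *)

Lemma sum_delta (R : realType) (I : finType) (F : I -> R) (k : I) :
  \sum_i F i * (k == i)%:R = F k.
Proof.
rewrite (bigD1 k) //= eqxx mulr1 big1 ?addr0 // => i /negPf ik.
by rewrite eq_sym ik mulr0.
Qed.

Section Flux.
Context (R : realType) (I : finType) (r : I -> I -> R).

Lemma flux_linear k :
  \sum_i \sum_j r i j * ((k == j)%:R - (k == i)%:R)
  = \sum_i r i k - \sum_j r k j.
Proof.
under eq_bigr => i _.
  under eq_bigr do rewrite mulrBr.
  rewrite sumrB sum_delta -mulr_suml.
  over.
by rewrite sumrB sum_delta.
Qed.

(** A transition moves one particle, hence changes two occupation numbers at once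
only if it goes from one of the two sites to the other. *)
Lemma flux_quadratic k l :
  \sum_i \sum_j r i j *
     (((k == j)%:R - (k == i)%:R) * ((l == j)%:R - (l == i)%:R))
  = (k == l)%:R * (\sum_i r i k + \sum_j r k j) - r k l - r l k.
Proof.
under eq_bigr => i _.
  under eq_bigr => j _.
    rewrite (_ : _ * _ = r i j * (l == j)%:R * (k == j)%:R
      + r i j * (l == i)%:R * (k == i)%:R
      - r i j * (k == i)%:R * (l == j)%:R
      - r i j * (l == i)%:R * (k == j)%:R); last by ring.
    over.
  rewrite !sumrB big_split /= !sum_delta -!mulr_suml.
  over.
rewrite !sumrB big_split /= !sum_delta -mulr_suml [l == k]eq_sym; ring.
Qed.
End Flux.

Section Generator.
Context (R : realType) (K N : nat) (theta p : R).
Implicit Types (eta : config K N) (i j k l : 'Z_K).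
Local Notation occ eta k := ((eta k)%:R : R).
Local Notation rate := (jump_rate theta p).

(** When the site [i] is empty the jump leaves the configuration alone, contrary
to the formula on the right, but then its rate vanishes. *)
Lemma jump_rateE eta i j (F : ('Z_K -> R) -> R) :
  (forall u v, u =1 v -> F u = F v) ->
  rate eta i j * (F (fun k => occ (jump i j eta) k) - F (fun k => occ eta k))
  = rate eta i j * (F (fun k => occ eta k + ((k == j)%:R - (k == i)%:R))
      - F (fun k => occ eta k)).
Proof.
move=> Fext; have [eta_i0|] := posnP (eta i); first by rewrite /jump_rate eta_i0 !mul0r.
move=> eta_i; congr (_ * (_ - _)); apply: Fext => k.
rewrite jumpE // natrD natrB; last by case: eqP => [->|].
by ring.
Qed.

Lemma rate_out eta k :
  \sum_j rate eta k j = occ eta k * (1 + theta + p * (N%:R / (N%:R - 1))).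
Proof.
rewrite /jump_rate -mulr_sumr !big_split /= -!mulr_sumr -mulr_suml sum_occupation.
have one (j : 'Z_K) : \sum_i (i == j)%:R = 1 :> R.
  rewrite (bigD1 j) //= eqxx big1 ?addr0 // => i /negPf -> //.
by rewrite !one mulr1.
Qed.

Lemma rate_in eta k :
  \sum_i rate eta i k = occ eta (k - 1) + theta * occ eta (k + 1)
    + p * (N%:R / (N%:R - 1)) * occ eta k.
Proof.
rewrite /jump_rate.
under eq_bigr => i _.
  have -> : (k == i + 1) = (k - 1 == i) by rewrite subr_eq.
  have -> : (k == i - 1) = (k + 1 == i) by rewrite -subr_eq opprK.
  (* The roles of [i] and [k] are symmetric in the mean-field part. *)
  rewrite (_ : _ * _ = occ eta i * (k - 1 == i)%:R
     + theta * (occ eta i * (k + 1 == i)%:R)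
     + p * (occ eta k / (N%:R - 1)) * occ eta i); last by ring.
  over.
by rewrite !big_split /= -!mulr_sumr !sum_delta sum_occupation; ring.
Qed.

(** The attraction between sites is symmetric, so its contributions to the inflow
and to the outflow cancel. *)
Lemma generator_occupation k eta :
  generator theta p (fun eta => occ eta k) eta
  = walk theta (fun k => occ eta k) k.
Proof.
rewrite /generator.
under eq_bigr => i _.
  under eq_bigr => j _.
    rewrite (jump_rateE _ _ _ (F := fun u => u k)) => [|u v ->//].
    rewrite addrC addrA addNr add0r.
    over.
  over.
by rewrite flux_linear rate_in rate_out /walk; ring.
Qed.

(** The action on quadratic functions is again of degree two. The quadratic terms
created by the attraction amount to a uniform killing at rate [2 p / (N - 1)],
because the total number of particles is fixed: at [k = l] the sum over the
partners of [k] contributes [N] times the occupation of [k]. *)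
Lemma generator_pair k l eta :
  generator theta p (fun eta => occ eta k * occ eta l) eta
  = walk theta (fun k => occ eta k * occ eta l) k
    + walk theta (fun l => occ eta k * occ eta l) l
    + (k == l)%:R * (occ eta (k - 1) + theta * occ eta (k + 1)
        + (1 + theta + 2 * p / (N%:R - 1) * N%:R) * occ eta k)
    - ((l == k + 1)%:R + theta * (l == k - 1)%:R) * occ eta k
    - ((k == l + 1)%:R + theta * (k == l - 1)%:R) * occ eta l
    - 2 * p / (N%:R - 1) * (occ eta k * occ eta l).
Proof.
rewrite /generator.
under eq_bigr => i _.
  under eq_bigr => j _.
    rewrite (jump_rateE _ _ _ (F := fun u => u k * u l)) => [|u v e].
    2: by rewrite !e.
    rewrite (_ : _ * _ = rate eta i j * ((k == j)%:R - (k == i)%:R) * occ eta l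
      + rate eta i j * ((l == j)%:R - (l == i)%:R) * occ eta k
      + rate eta i j * (((k == j)%:R - (k == i)%:R) *
         ((l == j)%:R - (l == i)%:R))); last by ring.
    over.
  rewrite !big_split /= -!mulr_suml.
  over.
rewrite !big_split /= -!mulr_suml !flux_linear flux_quadratic.
rewrite !rate_in !rate_out /jump_rate /walk; ring.
Qed.
End Generator.

(** * Moments of a stationary law *)

Section StationaryMoments.
Context (R : realType) (K N : nat) (theta p : R) (nu : probability (config K N) R).
Hypotheses (K_gt1 : (1 < K)%N) (N_ge2 : (2 <= N)%N).
Hypotheses (theta_gt0 : 0 < theta).
Hypothesis nu_stationary : stationary theta p nu.
Implicit Types (k l : 'Z_K).
Local Notation Kr := (K%:R : R).
Local Notation Nr := (N%:R : R).

Definition first_moment k : R := mean nu (fun eta => (eta k)%:R).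
Definition second_moment k l : R := mean nu (fun eta => (eta k)%:R * (eta l)%:R).

Let K_neq0 : Kr != 0. Proof. by rewrite pnatr_eq0; lia. Qed.
Let N1_gt0 : 0 < Nr - 1. Proof. by rewrite subr_gt0 ltr1n. Qed.

Lemma mean_generator f : mean nu (generator theta p f) = 0.
Proof. by rewrite /mean nu_stationary. Qed.

Lemma mean_walk (F : config K N -> 'Z_K -> R) k :
  mean nu (fun eta => walk theta (F eta) k)
  = walk theta (fun k => mean nu (F^~ k)) k.
Proof. by rewrite /walk meanB meanD !meanZ. Qed.

Lemma first_momentE k : first_moment k = Nr / Kr.
Proof.
have harmonic l : walk theta first_moment l = 0.
  have := mean_generator (fun eta => (eta l)%:R).
  rewrite (funext (@generator_occupation _ _ _ theta p l)) => <-.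
  by rewrite mean_walk.
have : \sum_l first_moment l = Nr.
  rewrite -mean_sum -[RHS](mean_cst nu); congr mean.
  by apply/funext => eta; exact: sum_occupation.
under eq_bigr do rewrite (walk_harmonic_const theta_gt0 harmonic _ k).
rewrite sumr_const card_ord Zp_cast // => <-.
by rewrite -[_ *+ K]mulr_natr mulfK.
Qed.

(** A closed linear system: two independent walks killed at rate
[2 p / (N - 1)], with sources at and next to the diagonal. *)
Lemma second_moment_eq k l :
  2 * p / (Nr - 1) * second_moment k l
  = walk theta (second_moment^~ l) k + walk theta (second_moment k) l
    + Nr / Kr * ((k == l)%:R * (2 * (1 + theta) + 2 * p / (Nr - 1) * Nr)
       - (1 + theta) * ((l == k + 1)%:R + (l == k - 1)%:R)).
Proof.
have := mean_generator (fun eta => (eta k)%:R * (eta l)%:R).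
rewrite (funext (@generator_pair _ _ _ theta p k l)).
rewrite /walk !(meanB, meanD, meanZ).
have occE j : mean nu (fun eta => (eta j)%:R) = Nr / Kr by exact: first_momentE.
rewrite !occE.
have -> : (k == l + 1) = (l == k - 1) by rewrite -subr_eq eq_sym.
have -> : (k == l - 1) = (l == k + 1) by rewrite eq_sym subr_eq.
rewrite /second_moment => eq0.
apply/eqP; rewrite -subr_eq0 -oppr_eq0 -[X in _ == X]eq0; apply/eqP; ring.
Qed.

(** The diagonal term absorbs the sources due to the walks; what is left is the
equation of the Green function on the cycle, with killing [e]. *)
Definition approx_moment (e : R) k l : R :=
  Nr / Kr * (k == l)%:R + Nr * (Nr - 1) / Kr * resolvent_expansion e (l - k).

(* The killing rate in the time scale of the difference of two particles,
   which is a symmetric walk of rate [1 + theta] in each direction. *)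
Let e : R := 2 * p / (1 + theta) / (Nr - 1).

(** Same system, up to the residual of the truncated Green function. *)
Lemma approx_moment_eq k l :
  2 * p / (Nr - 1) * approx_moment e k l
  = walk theta ((approx_moment e)^~ l) k + walk theta (approx_moment e k) l
    + Nr / Kr * ((k == l)%:R * (2 * (1 + theta) + 2 * p / (Nr - 1) * Nr)
       - (1 + theta) * ((l == k + 1)%:R + (l == k - 1)%:R))
    + 2 * p / (Nr - 1) * (Nr * (Nr - 1) / Kr * e ^+ 3 * potential3 R (l - k)).
Proof.
have lap := laplacian_resolvent_expansion K_gt1 e (l - k).
have -> : 2 * p / (Nr - 1) = e * (1 + theta).
  by rewrite /e; field; rewrite gt_eqF //= gt_eqF // addr_gt0. 
have -> : walk theta ((approx_moment e)^~ l) k + walk theta (approx_moment e k) l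
  = (1 + theta) * (Nr / Kr * ((l == k + 1)%:R + (l == k - 1)%:R - 2 * (k == l)%:R)
     + Nr * (Nr - 1) / Kr * laplacian (resolvent_expansion e) (l - k)).
  rewrite /walk /approx_moment /laplacian.
  have -> : (k - 1 == l) = (l == k - 1) by rewrite eq_sym.
  have -> : (k + 1 == l) = (l == k + 1) by rewrite eq_sym.
  have -> : (k == l - 1) = (l == k + 1) by rewrite eq_sym subr_eq.
  have -> : (k == l + 1) = (l == k - 1) by rewrite -subr_eq eq_sym.
  have -> : l - (k - 1) = l - k + 1 by ring.
  have -> : l - (k + 1) = l - k - 1 by ring.
  have -> : l + 1 - k = l - k + 1 by ring.
  have -> : l - 1 - k = l - k - 1 by ring.
  by ring.
rewrite lap subr_eq0 [l == k]eq_sym /approx_moment; ring.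
Qed.

Hypothesis p_gt0 : 0 < p.

(** The residual carries the factor [e ^+ 4]; dividing by the killing rate
costs one power of [e], and the remaining three give an error of order [1 / N]
after the prefactor [N ^+ 2]. Truncating one step earlier would give an error
of order [1], which is not negligible. *)
Lemma second_moment_approx k l :
  `|second_moment k l - approx_moment e k l|
  <= Nr * (Nr - 1) / Kr * e ^+ 3 * \sum_r `|potential3 R (r : 'Z_K)|.
Proof.
set M := \sum_r _; have M_ge r : `|potential3 R (r : 'Z_K)| <= M.
  by rewrite /M (bigD1 r) //= lerDl sumr_ge0.
have c_gt0 : 0 < 2 * p / (Nr - 1) by rewrite divr_gt0 // mulr_gt0.
have e_gt0 : 0 < e.
  apply: divr_gt0 => //; apply: divr_gt0; last exact: addr_gt0.
  exact: mulr_gt0.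
have w_ge0 : 0 <= Nr * (Nr - 1) / Kr * e ^+ 3.
  rewrite mulr_ge0 ?exprn_ge0 ?(ltW e_gt0) //.
  by rewrite divr_ge0 // mulr_ge0 // ltW.
have bound k' l' :
    `|Nr * (Nr - 1) / Kr * e ^+ 3 * potential3 R (l' - k')|
    <= Nr * (Nr - 1) / Kr * e ^+ 3 * M.
  by rewrite normrM (ger0_norm w_ge0) ler_wpM2l.
rewrite ler_norml lerNl; apply/andP; split.
  apply: (walk2_max_principle theta_gt0
    (D := fun k l => - (second_moment k l - approx_moment e k l)) c_gt0) => k' l'.
  have := bound k' l'; rewrite ler_norml => /andP[_]; rewrite -(ler_pM2l c_gt0).
  have := second_moment_eq k' l'; have := approx_moment_eq k' l'.
  rewrite /walk; lra.
apply: (walk2_max_principle theta_gt0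
  (D := fun k l => second_moment k l - approx_moment e k l) c_gt0) => k' l'.
have := bound k' l'; rewrite ler_norml => /andP[+ _]; rewrite -(ler_pM2l c_gt0).
have := second_moment_eq k' l'; have := approx_moment_eq k' l'.
rewrite /walk; lra.
Qed.
End StationaryMoments.

(** * The covariance *)

Lemma covariance_occupation (R : realType) (K N : nat) (theta p : R)
    (nu : probability (config K N) R) (k l : 'Z_K) :
  (1 < K)%N -> (2 <= N)%N -> 0 < theta -> stationary theta p nu ->
  fine (covariance nu (fun eta : config K N => (eta k)%:R / N%:R)
                      (fun eta : config K N => (eta l)%:R / N%:R))
  = second_moment nu k l / N%:R ^+ 2 - 1 / K%:R ^+ 2.
Proof.
move=> K_gt1 N_ge2 theta_gt0 nu_st.
have N_neq0 : N%:R != 0 :> R by rewrite pnatr_eq0; lia.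
have K_neq0 : K%:R != 0 :> R by rewrite pnatr_eq0; lia.
have density_mean j :
    fine (expectation nu (fun eta : config K N => (eta j)%:R / N%:R))
    = 1 / K%:R.
  transitivity (mean nu (fun eta => N%:R^-1 * (eta j)%:R)).
    by rewrite -[LHS]/(mean nu _); congr mean; apply/funext => eta; rewrite mulrC.
  rewrite meanZ -/(first_moment nu j) (first_momentE K_gt1 N_ge2 theta_gt0 nu_st).
  by field; rewrite ?N_neq0 ?K_neq0.
rewrite unlock !density_mean -/(mean nu _).
transitivity (mean nu (fun eta => N%:R ^- 2 * ((eta k)%:R * (eta l)%:R)
   - 1 / K%:R * ((N%:R^-1 * (eta k)%:R) + (N%:R^-1 * (eta l)%:R)) + 1 / K%:R ^+ 2)).
  congr mean; apply/funext => eta /=.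
  rewrite -[LHS]/(((eta k)%:R / N%:R - 1 / K%:R) * ((eta l)%:R / N%:R - 1 / K%:R)).
  by field; rewrite ?N_neq0 ?K_neq0.
rewrite meanD meanB !meanZ meanD !meanZ mean_cst -/(second_moment nu k l).
rewrite -/(first_moment nu k) -/(first_moment nu l).
rewrite !(first_momentE K_gt1 N_ge2 theta_gt0 nu_st).
by field; rewrite ?N_neq0 ?K_neq0.
Qed.

(** Here [q] stands for [p / (1 + theta)], so that [e = 2 q / (N - 1)]. *)
Definition covariance_main_term (R : realType) (K N : nat) (q : R) (r : 'Z_K) : R :=
  1 / (K%:R * N%:R) * ((r == 0)%:R - 1 / K%:R + 2 * q * potential1 R r)
  + 4 * q ^+ 2 * potential2 R r / (K%:R * N%:R ^+ 2).

Definition error_constant (R : realType) (K : nat) (q : R) (r : 'Z_K) : R :=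
  (4 * q ^+ 2 * `|potential2 R r|
   + 32 * q ^+ 3 * \sum_s `|potential3 R (s : 'Z_K)|) / K%:R.

(** Two errors add up: the one on the second moments together with the term in
[potential3], and the replacement of [N (N - 1)] by [N ^+ 2] in front of
[potential2]. *)
Lemma covariance_expansion (R : realType) (K N : nat) (theta p : R)
    (nu : probability (config K N) R) (k l : 'Z_K) :
  (1 < K)%N -> (2 <= N)%N -> 0 < theta -> 0 < p -> stationary theta p nu ->
  `|fine (covariance nu (fun eta : config K N => (eta k)%:R / N%:R)
                        (fun eta : config K N => (eta l)%:R / N%:R))
    - covariance_main_term N (p / (1 + theta)) (l - k)|
  <= error_constant (p / (1 + theta)) (l - k) / (N%:R ^+ 2 * (N%:R - 1)).
Proof.
move=> K_gt1 N_ge2 theta_gt0 p_gt0 nu_st.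
rewrite (covariance_occupation k l K_gt1 N_ge2 theta_gt0 nu_st).
have := second_moment_approx K_gt1 N_ge2 theta_gt0 nu_st p_gt0 k l.
rewrite /approx_moment /resolvent_expansion /error_constant /covariance_main_term.
set M := \sum_s _; set S := second_moment nu k l.
have : `|potential3 R (l - k)| <= M by rewrite /M (bigD1 (l - k)) //= lerDl sumr_ge0.
(* From here on only a real inequality in independent quantities is left. *)
move: (potential1 R (l - k)) (potential2 R (l - k)) (potential3 R (l - k)).
move=> G1 G2 G3 G3_M.
rewrite subr_eq0 [l == k]eq_sym; move: ((k == l)%:R) => d.
have -> : 2 * p / (1 + theta) = 2 * (p / (1 + theta)) by rewrite mulrA.
have : 0 < p / (1 + theta) by rewrite divr_gt0 // addr_gt0.
move: (p / (1 + theta)) => q q_gt0.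
have n_ge1 : 1 <= N%:R - 1 :> R by rewrite lerBrDr -(natrD R 1 1) ler_nat.
have -> : N%:R = (N%:R - 1) + 1 :> R by rewrite subrK.
rewrite addrK; move: (N%:R - 1) n_ge1 => n n_ge1.
have : 0 < K%:R :> R by rewrite ltr0n; lia.
move: K%:R => Kr K_gt0.
set T := (X in S - X); set err := (X in _ <= X) => S_T.
have n_gt0 : 0 < n by lra.
have N_gt0 : 0 < n + 1 by lra.
have M_ge0 : 0 <= M by exact: le_trans G3_M.
have errE : err / (n + 1) ^+ 2 = 8 * q ^+ 3 * M / (Kr * (n + 1) * n ^+ 2).
  by rewrite /err; field; rewrite !gt_eqF.
have -> : S / (n + 1) ^+ 2 - 1 / Kr ^+ 2
   - (1 / (Kr * (n + 1)) * (d - 1 / Kr + 2 * q * G1)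
      + 4 * q ^+ 2 * G2 / (Kr * (n + 1) ^+ 2))
  = (S - T) / (n + 1) ^+ 2 + 4 * q ^+ 2 * G2 / Kr / ((n + 1) ^+ 2 * n)
    + 8 * q ^+ 3 * G3 / (Kr * (n + 1) * n ^+ 2).
  by rewrite /T; field; rewrite !gt_eqF.
have S_part : `|(S - T) / (n + 1) ^+ 2| <= 8 * q ^+ 3 * M / (Kr * (n + 1) * n ^+ 2).
  rewrite -errE normrM [X in _ * X]ger0_norm ?invr_ge0 ?exprn_ge0 ?(ltW N_gt0) //.
  by rewrite ler_wpM2r // invr_ge0 exprn_ge0 // ltW.
have w_gt0 : 0 < 8 * q ^+ 3 / (Kr * (n + 1) * n ^+ 2).
  by rewrite divr_gt0 ?mulr_gt0 ?exprn_gt0.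
have G3_part : `|8 * q ^+ 3 * G3 / (Kr * (n + 1) * n ^+ 2)|
    <= 8 * q ^+ 3 * M / (Kr * (n + 1) * n ^+ 2).
  rewrite mulrAC [leRHS]mulrAC normrM (gtr0_norm w_gt0).
  by rewrite ler_wpM2l // ltW.
have G2_part : `|4 * q ^+ 2 * G2 / Kr / ((n + 1) ^+ 2 * n)|
    = 4 * q ^+ 2 * `|G2| / Kr / ((n + 1) ^+ 2 * n).
  have u_gt0 : 0 < 4 * q ^+ 2 / Kr / ((n + 1) ^+ 2 * n).
    by rewrite !divr_gt0 ?mulr_gt0 ?exprn_gt0.
  rewrite (_ : 4 * _ * G2 / Kr / _ = 4 * q ^+ 2 / Kr / ((n + 1) ^+ 2 * n) * G2).
  2: by ring.
  by rewrite normrM (gtr0_norm u_gt0); ring.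
(* This is [n + 1 <= 2 n]. *)
have tail : 8 * q ^+ 3 * M / (Kr * (n + 1) * n ^+ 2)
    <= 16 * q ^+ 3 * M / Kr / ((n + 1) ^+ 2 * n).
  rewrite -subr_ge0.
  rewrite (_ : _ - _ = 8 * q ^+ 3 * M * (n - 1) / (Kr * (n + 1) ^+ 2 * n ^+ 2)).
    by rewrite divr_ge0 ?mulr_ge0 ?exprn_ge0 ?subr_ge0 // ltW.
  by field; rewrite !gt_eqF.
apply: le_trans (ler_normD _ _) _; apply: le_trans (lerD (ler_normD _ _) (lexx _)) _.
rewrite G2_part.
rewrite (_ : (_ + _) / Kr / _ = 4 * q ^+ 2 * `|G2| / Kr / ((n + 1) ^+ 2 * n)
  + 2 * (16 * q ^+ 3 * M / Kr / ((n + 1) ^+ 2 * n))); last by ring.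
lra.
Qed.

Theorem theorem1p6 (R : realType) (K : nat) (theta p : R)
    (nu : forall N : nat, probability (config K N) R)
    (K_ge3 : (3 <= K)%N) (theta_gt0 : 0 < theta) (p_gt0 : 0 < p)
    (nu_stationary : forall N : nat, (2 <= N)%N -> stationary theta p (nu N))
    (k : nat) (k_ltK : (k < K)%N) :
  (fun N : nat =>
     fine (covariance (nu N)
             (fun eta : config K N => (eta 0)%:R / N%:R)
             (fun eta : config K N => (eta (k%:R : 'Z_K))%:R / N%:R)) : R^o)
  = (fun N : nat =>
       1 / (K%:R * N%:R) *
         ((k == 0%N)%:R - 1 / K%:R
          + (6 * k%:R * (k%:R - K%:R) + K%:R ^+ 2 - 1) / (6 * K%:R)
            * (p / (1 + theta)))
       + 1 / (K%:R ^+ 2 * N%:R ^+ 2) *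
         ((30 * k%:R * (K%:R - k%:R) * (k%:R * (K%:R - k%:R) + 2)
           - (K%:R ^+ 2 - 1) * (K%:R ^+ 2 + 11)) / 180)
         * (p / (1 + theta)) ^+ 2 : R^o)
    +o_\oo (fun N : nat => 1 / N%:R ^+ 2 : R^o).
Proof.
have K_gt1 : (1 < K)%N by exact: leq_trans K_ge3.
pose l : 'Z_K := k%:R; pose q := p / (1 + theta).
have lE : nat_of_ord l = k by rewrite /l val_Zp_nat // modn_small.
have l_eq0 : (l == 0) = (k == 0)%N by rewrite -lE.
have K_neq0 : K%:R != 0 :> R by rewrite pnatr_eq0; lia.
apply/eqaddoP => eps eps_gt0.
near=> N.
have N_ge2 : (2 <= N)%N by near: N; exact: nbhs_infty_ge.
have N_gt1 : 0 < N%:R - 1 :> R by rewrite subr_gt0 ltr1n.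
have N_gt0 : 0 < N%:R :> R by rewrite ltr0n; lia.
have := covariance_expansion 0 l K_gt1 N_ge2 theta_gt0 p_gt0 (nu_stationary N N_ge2).
rewrite subr0 -/q.
rewrite (_ : covariance_main_term N q l = 1 / (K%:R * N%:R) *
         ((k == 0%N)%:R - 1 / K%:R
          + (6 * k%:R * (k%:R - K%:R) + K%:R ^+ 2 - 1) / (6 * K%:R) * q)
       + 1 / (K%:R ^+ 2 * N%:R ^+ 2) *
         ((30 * k%:R * (K%:R - k%:R) * (k%:R * (K%:R - k%:R) + 2)
           - (K%:R ^+ 2 - 1) * (K%:R ^+ 2 + 11)) / 180)
         * q ^+ 2); last first.
  rewrite /covariance_main_term l_eq0 /potential1 /potential2 /arc_product lE.
  by field; rewrite K_neq0 gt_eqF.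
move=> /le_trans; apply.
rewrite [X in _ <= _ * X]ger0_norm; last by rewrite divr_ge0.
rewrite div1r invfM [leLHS]mulrA [leLHS]mulrAC.
rewrite ler_wpM2r ?invr_ge0 ?exprn_ge0 ?(ltW N_gt0) //.
rewrite ler_pdivrMr // -ler_pdivrMl // lerBrDr.
near: N; exact: nbhs_infty_ger.
Unshelve. all: by end_near.
Qed.
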